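(* Let $X$ be an order continuous Banach lattice. The un-topology on $X$ is locally convex if and only if $X$ is atomic.
   Context: Let $X$ be a Banach lattice with positive cone $X_+$. ''Order continuous Banach lattice'' means a Banach lattice with order continuous norm. A net $(x_\alpha)$ in $X$ un-converges to $x\in X$ if $\bigl\lVert |x_\alpha-x|\wedge u\bigr\rVert\to 0$ for every $u\in X_+$. The un-topology on $X$ is the linear topology whose base of zero neighborhoods is given by the sets $V_{\varepsilon,u}=\{x\in X : \lVert |x|\wedge u\rVert<\varepsilon\}$, where $\varepsilon>0$ and $0\ne u\in X_+$; convergence of nets in this topology is exactly un-convergence. A non-zero vector $a\in X_+$ is an atom if the principal ideal $I_a$ generated by $a$ coincides with $\operatorname{span}\{a\}$. $X$ is atomic if $X$ is the band generated by all the atoms of $X$. *)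

(* Defs.v *)
From HB Require Import structures.
From mathcomp Require Import all_boot all_order all_algebra.
From mathcomp Require Import all_classical all_reals all_analysis.

Set Implicit Arguments.
Unset Strict Implicit.
Unset Printing Implicit Defensive.

Import Order.TTheory GRing.Theory Num.Theory.
Import numFieldNormedType.Exports.

Local Open Scope classical_set_scope.
Local Open Scope ring_scope.

Reserved Notation "x <=v y" (at level 70, no associativity).
Reserved Notation "x /\v y" (at level 48, left associativity).
Reserved Notation "x \/v y" (at level 52, left associativity).

(* Real Banach lattices. The order is not taken from [Order.Lattice]: its join
   with [GRing.Zmodule] is already fixed by the structures of real domains
   ([Num.POrderedZmodule], [Num.RealDomain]), and Hierarchy Builder rejects
   a structure on normed modules that inherits from both. *)
HB.mixin Record CompleteNormedModule_isBanachLattice (R : realType) X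
    & CompleteNormedModule R X := {
  lev : rel X ;
  meetv : X -> X -> X ;
  joinv : X -> X -> X ;
  lev_refl : reflexive lev ;
  lev_anti : antisymmetric lev ;
  lev_trans : transitive lev ;
  lev_meet : forall x y z, lev z (meetv x y) = lev z x && lev z y ;
  lev_join : forall x y z, lev (joinv x y) z = lev x z && lev y z ;
  lev_add2r : forall x y z, lev x y -> lev (x + z) (y + z) ;
  scalev_ge0 : forall (t : R) x, 0 <= t -> lev 0 x -> lev 0 (t *: x) ;
  lev_norm : forall x y,
    lev (joinv x (- x)) (joinv y (- y)) -> `|x| <= `|y|
}.

#[short(type="banachLatticeType")]
HB.structure Definition BanachLattice (R : realType) :=
  {X of CompleteNormedModule_isBanachLattice R X & CompleteNormedModule R X}.

Declare Scope vlattice_scope.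
Delimit Scope vlattice_scope with V.
Notation "x <=v y" := (lev x y) : vlattice_scope.
Notation "x /\v y" := (meetv x y) : vlattice_scope.
Notation "x \/v y" := (joinv x y) : vlattice_scope.
Open Scope vlattice_scope.

Section BanachLatticeDefs.
Context {R : realType} {X : banachLatticeType R}.
Implicit Types (x y a : X) (A I B D : set X).

Definition absv x : X := x \/v (- x).

Definition is_inf A x :=
  (forall y, A y -> x <=v y) /\ (forall z, (forall y, A y -> z <=v y) -> z <=v x).

Definition is_sup A x :=
  (forall y, A y -> y <=v x) /\ (forall z, (forall y, A y -> y <=v z) -> x <=v z).

Definition order_ideal I :=
  [/\ I 0, (forall x y, I x -> I y -> I (x + y)),
      (forall (t : R) x, I x -> I (t *: x))
    & (forall x y, I y -> absv x <=v absv y -> I x)].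

Definition band B :=
  order_ideal B /\ (forall D x, D `<=` B -> is_sup D x -> B x).

Definition principal_ideal a : set X := smallest order_ideal [set a].

Definition atom a :=
  [/\ a != 0, 0 <=v a & principal_ideal a = range (fun t : R => t *: a)].

End BanachLatticeDefs.

Definition atomic (R : realType) (X : banachLatticeType R) :=
  smallest band [set a : X | atom a] = [set: X].

Definition directed (I : Type) (leI : I -> I -> Prop) :=
  [/\ inhabited I, (forall i, leI i i),
      (forall i j k, leI i j -> leI j k -> leI i k)
    & (forall i j, exists k, leI i k /\ leI j k)].

Definition tails (I : Type) (leI : I -> I -> Prop) : set_system I :=
  filter_from [set: I] (fun i => [set j | leI i j]).

Definition order_continuous_norm (R : realType) (X : banachLatticeType R) :=
  forall (I : Type) (leI : I -> I -> Prop) (x : I -> X),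
    directed leI ->
    (forall i j, leI i j -> x j <=v x i) -> is_inf (range x) 0 ->
    (fun i => `|x i|) @ tails leI --> (0 : R).

(* The condition under which the library calls a topological vector space
   a [tvsType]. *)
Definition is_locally_convex (R : numDomainType) (E : topologicalLmodType R) :=
  exists2 B : set_system E, (forall b, b \in B -> convex_set b) & basis B.

Section BanachLatticeTheory.
Context {R : realType} {X : banachLatticeType R}.
Implicit Types (x y z a b u w : X).

Lemma levv_trans x y z : x <=v y -> y <=v z -> x <=v z.
Proof. exact: lev_trans. Qed.

Lemma lev_addl x y z : x <=v y -> z + x <=v z + y.
Proof. by move=> xy; rewrite ![z + _]addrC; exact: lev_add2r. Qed.

Lemma lev_add x y z w : x <=v y -> z <=v w -> x + z <=v y + w.
Proof. by move=> /(lev_add2r _ _ z) xy /(lev_addl y); exact: levv_trans. Qed.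

Lemma lev_addr_ge0 x y : 0 <=v y -> x <=v x + y.
Proof. by move=> /(lev_addl x); rewrite addr0. Qed.

Lemma subv_ge0 x y : (0 <=v y - x) = (x <=v y).
Proof.
apply/idP/idP => [/(lev_add2r _ _ x)|/(lev_add2r _ _ (- x))].
  by rewrite add0r subrK.
by rewrite subrr.
Qed.

Lemma lev_subl x y z : (x - y <=v z) = (x <=v z + y).
Proof. by rewrite -subv_ge0 -[RHS]subv_ge0 opprB addrA. Qed.

Lemma lev_scale (t : R) x y : 0 <= t -> x <=v y -> t *: x <=v t *: y.
Proof.
by move=> t0 xy; rewrite -subv_ge0 -scalerBr scalev_ge0// subv_ge0.
Qed.

Lemma lev_scale_ge (s t : R) x : s <= t -> 0 <=v x -> s *: x <=v t *: x.
Proof.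
by move=> st x0; rewrite -subv_ge0 -scalerBl scalev_ge0// subr_ge0.
Qed.

Lemma levIl x y : x /\v y <=v x.
Proof. by have := lev_refl (x /\v y); rewrite lev_meet => /andP[]. Qed.

Lemma levIr x y : x /\v y <=v y.
Proof. by have := lev_refl (x /\v y); rewrite lev_meet => /andP[]. Qed.

Lemma levUl x y : x <=v x \/v y.
Proof. by have := lev_refl (x \/v y); rewrite lev_join => /andP[]. Qed.

Lemma levUr x y : y <=v x \/v y.
Proof. by have := lev_refl (x \/v y); rewrite lev_join => /andP[]. Qed.

Lemma lev_meet2 x y z w : x <=v y -> z <=v w -> x /\v z <=v y /\v w.
Proof.
by move=> xy zw; rewrite lev_meet (levv_trans (levIl _ _) xy)
  (levv_trans (levIr _ _) zw).
Qed.

Lemma meetv_ge0 x y : 0 <=v x -> 0 <=v y -> 0 <=v x /\v y.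
Proof. by rewrite lev_meet => -> ->. Qed.

Lemma absv_ge0 x : 0 <=v absv x.
Proof.
have h : 0 <=v absv x + absv x.
  by rewrite -(subrr x); exact: lev_add (levUl _ _) (levUr _ _).
have : 0 <=v (2^-1 : R) *: (absv x + absv x) by rewrite scalev_ge0// invr_ge0.
by rewrite -[absv x + _]mulr2n -(scaler_nat 2 (absv x)) scalerA mulVf ?pnatr_eq0// scale1r.
Qed.

Lemma absv_ge0E x : 0 <=v x -> absv x = x.
Proof.
move=> x0; apply: lev_anti; rewrite levUl andbT lev_join lev_refl/=.
by apply: (levv_trans _ x0); rewrite -subv_ge0 sub0r opprK.
Qed.

Lemma absvN x : absv (- x) = absv x.
Proof.
by apply: lev_anti; rewrite /absv opprK !lev_join !levUl !levUr.
Qed.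

Lemma absv0 : absv (0 : X) = 0.
Proof. by rewrite absv_ge0E// lev_refl. Qed.

Lemma absv_add x y : absv (x + y) <=v absv x + absv y.
Proof.
rewrite lev_join opprD; apply/andP; split; apply: lev_add;
  by rewrite ?levUl ?levUr.
Qed.

Lemma absv_scale (t : R) x : absv (t *: x) <=v `|t| *: absv x.
Proof.
wlog t0 : t / 0 <= t.
  move=> h; have [/h//|/ltW t0] := leP 0 t.
  by rewrite -absvN -scaleNr -normrN; apply: h; rewrite oppr_ge0.
by rewrite ger0_norm// lev_join -scalerN !lev_scale// ?levUl ?levUr.
Qed.

Lemma meetv_add a b u : 0 <=v a -> 0 <=v b -> 0 <=v u ->
  (a + b) /\v u <=v (a /\v u) + (b /\v u).
Proof.
move=> a0 b0 u0; set z := _ /\v u.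
suff : z - (a /\v u) <=v b /\v u by rewrite lev_subl addrC.
rewrite lev_meet; apply/andP; split; rewrite lev_subl.
  rewrite addrC -lev_subl lev_meet; apply/andP; split; rewrite lev_subl.
    exact: levIl.
  exact: levv_trans (levIr _ _) (lev_addr_ge0 _ b0).
by apply: levv_trans (levIr _ _) (lev_addr_ge0 _ _); exact: meetv_ge0.
Qed.

Lemma meetv_scale (s t : R) a u : 1 <= s -> t <= s -> 0 <=v a -> 0 <=v u ->
  (t *: a) /\v u <=v s *: (a /\v u).
Proof.
move=> s1 ts a0 u0; have s0 : 0 < s by exact: lt_le_trans s1.
have s'0 : 0 <= s^-1 by rewrite invr_ge0 ltW.
have sK v : s^-1 *: (s *: v : X) = v by rewrite scalerA mulVf ?gt_eqF// scale1r.
set w := _ /\v u.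
suff /(lev_scale (ltW s0)) : s^-1 *: w <=v a /\v u.
  by rewrite scalerA mulfV ?gt_eqF// scale1r.
rewrite lev_meet; apply/andP; split.
  rewrite -[X in _ <=v X]sK; apply: lev_scale => //.
  exact: levv_trans (levIl _ _) (lev_scale_ge ts a0).
rewrite -[X in _ <=v X]sK; apply: lev_scale => //.
apply: levv_trans (levIr _ _) _.
by rewrite -{1}[u]scale1r lev_scale_ge.
Qed.

Lemma lev_norm_ge0 x y : 0 <=v x -> x <=v y -> `|x| <= `|y|.
Proof.
move=> x0 xy; apply: lev_norm; rewrite -!/(absv _) !absv_ge0E//.
exact: levv_trans x0 xy.
Qed.

End BanachLatticeTheory.

Section UnTopology.
Context {R : realType} {X : banachLatticeType R}.
Implicit Types (x y u : X) (e : R).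

Definition un_ball e u : set X := [set x | `|absv x /\v u| < e].

Lemma un_ball0 e u : 0 < e -> 0 <=v u -> un_ball e u 0.
Proof.
move=> e0 u0; rewrite /un_ball/= absv0 (_ : 0 /\v u = 0) ?normr0//.
by apply: lev_anti; rewrite levIl lev_meet lev_refl.
Qed.

Lemma un_ballD e1 e2 u x y : 0 <=v u ->
  un_ball e1 u x -> un_ball e2 u y -> un_ball (e1 + e2) u (x + y).
Proof.
move=> u0 xe ye; apply: le_lt_trans (ltrD xe ye).
apply: le_trans (ler_normD _ _); apply: lev_norm_ge0.
  by rewrite meetv_ge0// absv_ge0.
apply: levv_trans (meetv_add (absv_ge0 _) (absv_ge0 _) u0).
by rewrite lev_meet2 ?lev_refl// absv_add.
Qed.

Lemma un_ballZ e u x (s t : R) : 0 <=v u -> 1 <= s -> `|t| <= s ->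
  un_ball e u x -> un_ball (s * e) u (t *: x).
Proof.
move=> u0 s1 ts xe; have s0 : 0 < s by exact: lt_le_trans s1.
apply: (@le_lt_trans _ _ (s * `|absv x /\v u|)); last by rewrite ltr_pM2l.
rewrite -{1}(gtr0_norm s0) -normrZ; apply: lev_norm_ge0.
  by rewrite meetv_ge0// absv_ge0.
apply: levv_trans (meetv_scale s1 ts (absv_ge0 x) u0).
by rewrite lev_meet2 ?lev_refl// absv_scale.
Qed.

Lemma un_ball_norm e u x : 0 <=v u -> `|x| < e -> un_ball e u x.
Proof.
move=> u0; apply: le_lt_trans; apply: (@le_trans _ _ `|absv x|).
  by apply: lev_norm_ge0 (levIl _ _); rewrite meetv_ge0// absv_ge0.
by apply: lev_norm; rewrite -!/(absv _) (absv_ge0E (absv_ge0 x)) lev_refl.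
Qed.

Lemma un_ballS e1 e2 u1 u2 : e1 <= e2 -> 0 <=v u2 -> u2 <=v u1 ->
  un_ball e1 u1 `<=` un_ball e2 u2.
Proof.
move=> e12 u0 u12 x xe; apply: lt_le_trans e12; apply: le_lt_trans xe.
apply: lev_norm_ge0; first by rewrite meetv_ge0// absv_ge0.
by rewrite lev_meet2// lev_refl.
Qed.

End UnTopology.

(* [un X] is [X] as a vector space, with the un-topology in place of the norm
   topology. *)
Definition un (R : realType) (X : banachLatticeType R) : Type := X.

HB.instance Definition _ (R : realType) (X : banachLatticeType R) :=
  GRing.Lmodule.copy (un X) X.

Section UnInstances.
Context (R : realType) (X : banachLatticeType R).

(* The index [u] may be zero: [un_ball e 0] is all of [X], so that this only
   matters for the zero space, where no other [u] is available. *)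
Definition un_nbhs (x : un X) : set_system (un X) :=
  filter_from [set p : R * X | 0 < p.1 /\ 0 <=v p.2]
    (fun p => [set y | un_ball p.1 p.2 (y - x)]).

HB.instance Definition _ := hasNbhs.Build (un X) un_nbhs.

Lemma un_nbhs_filter (x : un X) : ProperFilter (nbhs x).
Proof.
apply: filter_from_proper; last first.
  by move=> [e u] /= [e0 u0]; exists x; rewrite /= subrr; exact: un_ball0.
apply: filter_from_filter; first by exists (1, 0); split; rewrite //= lev_refl.
move=> [e1 u1] [e2 u2] /= [e10 u10] [e20 u20].
exists (Num.min e1 e2, u1 \/v u2) => /=.
  by split; [rewrite lt_min e10|exact: levv_trans u10 (levUl _ _)].
move=> y ye; split.
  by apply: un_ballS ye => //; [rewrite ge_min lexx|exact: levUl].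
by apply: un_ballS ye => //; [rewrite ge_min lexx orbT|exact: levUr].
Qed.

Lemma un_nbhs_singleton (x : un X) (A : set (un X)) : nbhs x A -> A x.
Proof.
by move=> [[e u] /= [e0 u0]]; apply; rewrite /= subrr; exact: un_ball0.
Qed.

Lemma un_nbhs_nbhs (x : un X) (A : set (un X)) :
  nbhs x A -> nbhs x (nbhs^~ A).
Proof.
move=> [[e u] /= [e0 u0]] sA; have e20 : 0 < e / 2 by rewrite divr_gt0.
exists (e / 2, u) => //= y xy; exists (e / 2, u) => //= z yz.
apply: sA => /=; rewrite [e]splitr -(subrKA y); exact: un_ballD.
Qed.

HB.instance Definition _ := Nbhs_isNbhsTopological.Build (un X)
  un_nbhs_filter un_nbhs_singleton un_nbhs_nbhs.

Lemma un_add_continuous : continuous (fun z : un X * un X => z.1 + z.2).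
Proof.
move=> [x y] A /= [[e u] /= [e0 u0]] sA.
have e20 : 0 < e / 2 by rewrite divr_gt0.
exists ([set z | un_ball (e / 2) u (z - x)], [set z | un_ball (e / 2) u (z - y)]).
  by split; exists (e / 2, u).
move=> [x' y'] /= [xx yy]; apply: sA => /=.
by rewrite [e]splitr opprD addrACA; exact: un_ballD.
Qed.

HB.instance Definition _ :=
  PreTopologicalNmodule_isTopologicalNmodule.Build (un X) un_add_continuous.

Lemma un_scale_continuous : continuous (fun z : R^o * un X => z.1 *: z.2).
Proof.
move=> [t x] A /= [[e u] /= [e0 u0]] sA.
pose s : R := `|t| + 1; have s1 : 1 <= s by rewrite lerDr.
have s0 : 0 < s by exact: lt_le_trans s1.
pose n : R := `|x : X| + 1.
have n0 : 0 < n by rewrite ltr_wpDl.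
have e20 : 0 < e / 2 by rewrite divr_gt0.
exists (ball (t : R^o) (Num.min 1 (e / 2 / n)),
  [set z | un_ball (s^-1 * (e / 2)) u (z - x)]) => /=.
  split; first by apply: nbhsx_ballx; rewrite lt_min ltr01 divr_gt0.
  by exists (s^-1 * (e / 2), u) => //=; split=> //; rewrite mulr_gt0// invr_gt0.
move=> [t' x'] /= [tt xx]; apply: sA => /=.
move: tt; rewrite -ball_normE/= lt_min => /andP[tt1 tte].
rewrite [e]splitr.
have -> : t' *: x' - t *: x = t' *: (x' - x) + (t' - t) *: (x : X).
  by rewrite scalerBr scalerBl addrA subrK.
apply: un_ballD => //.
  have -> : e / 2 = s * (s^-1 * (e / 2)) by rewrite mulrA mulfV ?mul1r ?gt_eqF.
  apply: un_ballZ => //; rewrite -(subrK t t') /s addrC.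
  by apply: le_trans (ler_normD _ _) _; rewrite lerD2l distrC ltW.
apply: un_ball_norm => //; rewrite normrZ.
apply: (@le_lt_trans _ _ (`|t' - t| * n)).
  by rewrite ler_wpM2l// lerDl.
by rewrite distrC -ltr_pdivlMr.
Qed.

HB.instance Definition _ :=
  TopologicalNmodule_isTopologicalLmodule.Build R (un X) un_scale_continuous.

(* [un X] unfolds to [X], which carries the norm topology: the canonical
   topology of [un X] is the un-topology nevertheless. *)
Lemma un_nbhsE (x : (un X : topologicalLmodType R)) : nbhs x = un_nbhs x.
Proof. by []. Qed.

Lemma un_nbhs_neq0P (z : X) (x : un X) (A : set (un X)) : z != 0 ->
  nbhs x A <-> exists e (u : X), [/\ 0 < e, 0 <=v u, u != 0
    & [set y | un_ball e u (y - x)] `<=` A].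
Proof.
move=> z0; split=> [[[e u] /= [e0 u0]] sA|[e [u [e0 u0 _ sA]]]]; last first.
  by exists (e, u).
have uz : absv z <=v u + absv z by rewrite addrC lev_addr_ge0.
exists e, (u + absv z); split=> //.
- exact: levv_trans (absv_ge0 z) uz.
- apply: contra_neq z0 => u_0; apply/eqP; rewrite -normr_le0 -(@normr0 _ X).
  by apply: lev_norm; rewrite -!/(absv _) absv0 -u_0.
- by move=> y /= ye; apply: sA; apply: un_ballS ye => //; exact: lev_addr_ge0 (absv_ge0 z).
Qed.

Lemma un_cvgP (F : set_system (un X)) (x : un X) : Filter F ->
  F --> x <-> forall u : X, 0 <=v u ->
    (fun y : un X => `|absv (y - x : X) /\v u|) @ F --> (0 : R).
Proof.
move=> FF; split=> [Fx u u0|h A [[e u] /= [e0 u0]] sA].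
  apply/cvgr0Pnorm_lt => e e0; apply: Fx.
  by exists (e, u) => //= y; rewrite /un_ball/= normr_id.
have /cvgr0Pnorm_lt/(_ _ e0) := h u u0.
by apply: filterS => y; rewrite normr_id => /sA.
Qed.

End UnInstances.

(* Main.v *)
(* Atomic implies locally convex: the vectors [u] all of whose [un_ball e (absv u)]
   contain an open convex set around 0 form a band, by order continuity. For an
   atom [a] and [e <= `|a|] the ball itself is convex, because [absv x /\v k *: a]
   does not depend on [k >= 1] as soon as [absv x /\v a] has norm less than
   [`|a|]. So in an atomic lattice every [u] has this property.

   Locally convex implies atomic: otherwise there is [u > 0] with no atom below
   it. Take a convex neighborhood [W] inside [un_ball (`|u| / 2) u] and
   [un_ball d v `<=` W]. The interval below [u] can be split into pieces [x] so
   small that every multiple of [x] lies in [un_ball d v], and convexity puts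
   sums of such pieces, hence vectors arbitrarily close to [u], in [W]. *)
Require Import Defs.
From mathcomp Require Import all_boot all_order all_algebra.
From mathcomp Require Import all_classical all_reals all_analysis.
From mathcomp Require Import lra.

Set Implicit Arguments.
Unset Strict Implicit.
Unset Printing Implicit Defensive.

Import Order.TTheory GRing.Theory Num.Theory.
Import numFieldNormedType.Exports.

Local Open Scope classical_set_scope.
Local Open Scope ring_scope.

(** * Vector lattice facts: disjointness, intervals and a criterion for atoms *)

Section VectorLattice.
Context {R : realType} {X : banachLatticeType R}.
Implicit Types (x y z a b u v w : X) (A G S : set X).

Lemma lev_le0_anti x : 0 <=v x -> x <=v 0 -> x = 0.
Proof. by move=> x0 x0'; apply: lev_anti; rewrite x0 x0'. Qed.

Lemma lev_subr_swap x y z : (x <=v y - z) = (z <=v y - x).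
Proof. by rewrite -subv_ge0 -[RHS]subv_ge0 addrAC. Qed.

Lemma lev_subr_addl x y z : (x <=v y - z) = (z + x <=v y).
Proof. by rewrite -subv_ge0 -[RHS]subv_ge0 opprD addrA. Qed.

Lemma addv_ge0 x y : 0 <=v x -> 0 <=v y -> 0 <=v x + y.
Proof. by move=> x0 y0; rewrite -[0 in X in X <=v _]addr0; exact: lev_add. Qed.

Lemma meetvC x y : x /\v y = y /\v x.
Proof. by apply: lev_anti; rewrite !lev_meet !levIl !levIr. Qed.

Lemma meetv_idPl x y : x <=v y -> x /\v y = x.
Proof. by move=> xy; apply: lev_anti; rewrite levIl lev_meet lev_refl. Qed.

Lemma joinv_le_addr x y : 0 <=v x -> 0 <=v y -> x \/v y <=v x + y.
Proof.
by move=> x0 y0; rewrite lev_join lev_addr_ge0//= addrC lev_addr_ge0.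
Qed.

Lemma lev_absv x : x <=v absv x. Proof. exact: levUl. Qed.

Lemma lev_opp_absv x : - x <=v absv x. Proof. exact: levUr. Qed.

Lemma normv_absv x : `|absv x| = `|x|.
Proof.
by apply/eqP; rewrite eq_le; apply/andP; split; apply: lev_norm;
  rewrite -!/(absv _) (absv_ge0E (absv_ge0 x)) lev_refl.
Qed.

Lemma absv_joinv x y : absv (x \/v y) <=v absv x + absv y.
Proof.
have ax := absv_ge0 x; have ay := absv_ge0 y.
have axy : absv x <=v absv x + absv y by exact: lev_addr_ge0.
have ayx : absv y <=v absv x + absv y by rewrite addrC lev_addr_ge0.
rewrite lev_join lev_join (levv_trans (lev_absv x) axy).
rewrite (levv_trans (lev_absv y) ayx)/=.
apply: levv_trans axy; apply: levv_trans (lev_opp_absv x).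
by rewrite -sub0r lev_subl addrC lev_subr_addl addr0 levUl.
Qed.

(** [x + y - z] is a lower bound of both [x] and [y]. *)
Lemma disjoint_add_le x y z : x /\v y = 0 -> 0 <=v x -> 0 <=v y ->
  x <=v z -> y <=v z -> x + y <=v z.
Proof.
move=> xy0 x0 y0 xz yz.
rewrite -[z]add0r -lev_subl -xy0 lev_meet !lev_subl; apply/andP; split.
  by rewrite lev_addl.
by rewrite addrC lev_addl.
Qed.

(** Adding the meet of the residuals to [x /\v y] gives again a lower bound of [x] and [y]. *)
Lemma meet_residual_disjoint x y : (x - x /\v y) /\v (y - x /\v y) = 0.
Proof.
apply: lev_le0_anti; first by rewrite meetv_ge0// subv_ge0 ?levIl ?levIr.
set m := x /\v y; set p := _ /\v _.
rewrite -(subrr m) lev_subr_addl (lev_meet x y).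
by rewrite -!lev_subr_addl levIl levIr.
Qed.

Lemma scalev_sub_archimedean x y : 0 <=v x -> (forall n, x *+ n <=v y) -> x = 0.
Proof.
move=> x0 xy; apply/eqP; rewrite -normr_le0 leNgt; apply/negP => nx.
have xn n : 0 <=v x *+ n by rewrite -scaler_nat scalev_ge0.
have := archi_boundP (divr_ge0 (normr_ge0 y) (ltW nx)).
set n := Num.bound _; rewrite ltr_pdivrMr// => yn.
have := lev_norm_ge0 (xn n) (xy n); rewrite normrMn -mulr_natl.
by move=> /(lt_le_trans yn); rewrite ltxx.
Qed.

Lemma scalev_inj a (s t : R) : a != 0 -> s *: a = t *: a -> s = t.
Proof.
move=> a0 /eqP; rewrite -subr_eq0 -scalerBl scaler_eq0 (negbTE a0) orbF subr_eq0.
by move/eqP.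
Qed.

Lemma smallest_order_ideal A : order_ideal (smallest order_ideal A).
Proof.
split=> [I [[]]//|x y Sx Sy I [iI AI]|t x Sx I [iI AI]|x y Sy xy I [iI AI]].
- by case: (iI) => _ h _ _; apply: h; [exact: Sx|exact: Sy].
- by case: (iI) => _ _ h _; apply: h; exact: Sx.
- by case: (iI) => _ _ _ h; apply: h xy; exact: Sy.
Qed.

Lemma smallest_band A : band (smallest band A).
Proof.
split; last first.
  move=> D x DS Dx B [bB AB]; apply: bB.2 Dx => y Dy.
  by apply: (DS _ Dy).
split=> [B [[[]]]//|x y Sx Sy B [bB AB]|t x Sx B [bB AB]|x y Sy xy B [bB AB]];
  case: (bB) => -[? hD hZ hS] _.
- by apply: hD; [exact: Sx|exact: Sy].
- by apply: hZ; exact: Sx.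
- by apply: hS xy; exact: Sy.
Qed.

Lemma interval_atom a (k : R) x : atom a -> 0 <= k -> 0 <=v x -> x <=v k *: a ->
  exists t : R, x = t *: a.
Proof.
move=> [a0 age0 aE] k0 x0 xa.
suff : principal_ideal a x by rewrite aE => -[t _ <-]; exists t.
have [_ _ hZ hS] := smallest_order_ideal [set a].
apply: (hS _ (k *: a)); first by apply: hZ; exact: sub_gen_smallest.
by rewrite !absv_ge0E// scalev_ge0.
Qed.

(** A Dedekind cut: with [s] the supremum of the multiples of [w] below [x], comparability gives
    [absv (x - s *: w) <=v d *: w] for every [d > 0]. *)
Lemma totally_ordered_interval w x : 0 <=v w -> 0 <=v x -> x <=v w ->
  (forall s : R, 0 <= s -> s <= 1 -> s *: w <=v x \/ x <=v s *: w) ->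
  exists s : R, x = s *: w.
Proof.
move=> w0 x0 xw dich.
pose E : set R := [set s | [/\ 0 <= s, s <= 1 & s *: w <=v x]].
have E0 : E 0 by split; rewrite ?scale0r.
have supE : has_sup E by split; [exists 0|exists 1 => s []].
have s0 : 0 <= sup E by apply: ub_le_sup E0; case: supE.
exists (sup E).
apply/eqP; rewrite -subr_eq0 -normr_le0; apply/ler_addgt0Pr => e e0.
pose d := e / (`|w| + 1).
have d0 : 0 < d by rewrite divr_gt0// ltr_wpDl.
suff hd : absv (x - sup E *: w) <=v d *: w.
  rewrite add0r -normv_absv.
  apply: le_trans (lev_norm_ge0 (absv_ge0 _) hd) _.
  rewrite normrZ gtr0_norm// /d mulrAC ler_pdivrMr ?ltr_wpDl//.
  by rewrite ler_wpM2l ?ltW// ltrDl.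
rewrite lev_join; apply/andP; split.
  rewrite lev_subl -scalerDl.
  (* Comparability is known only for coefficients up to 1; beyond 1, [x <=v w] suffices. *)
  have [le1|/ltW gt1] := leP (d + sup E) 1; last first.
    by apply: levv_trans xw _; rewrite -{1}[w]scale1r lev_scale_ge.
  have dE0 : 0 <= d + sup E by rewrite addr_ge0// ltW.
  have [h|//] := dich _ dE0 le1.
  have /(ub_le_sup supE.2) : E (d + sup E) by [].
  by rewrite gerDr leNgt d0.
rewrite opprB lev_subl addrC -lev_subl -scalerBl.
have [s [_ _ sx] /ltW ds] := sup_adherent d0 supE.
exact: levv_trans (lev_scale_ge ds w0) sx.
Qed.

(** The residuals of [x] and [s *: w] over their meet are disjoint, so one vanishes and the two
    vectors are comparable. The cut argument then puts [[0, w]] on a line. *)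
Lemma indecomposable_atom w : w != 0 -> 0 <=v w ->
  (forall a b, 0 <=v a -> 0 <=v b -> a <=v w -> b <=v w -> a /\v b = 0 ->
    a = 0 \/ b = 0) -> atom w.
Proof.
move=> w0 wge0 indec.
have line x : 0 <=v x -> x <=v w -> exists s : R, x = s *: w.
  move=> x0 xw; apply: totally_ordered_interval => // s s0 s1.
  have sw0 : 0 <=v s *: w by rewrite scalev_ge0.
  have sww : s *: w <=v w by rewrite -[X in _ <=v X]scale1r lev_scale_ge.
  have m0 : 0 <=v x /\v (s *: w) by exact: meetv_ge0.
  have [||||||] := indec (x - x /\v (s *: w)) (s *: w - x /\v (s *: w)).
  - by rewrite subv_ge0 levIl.
  - by rewrite subv_ge0 levIr.
  - by apply: levv_trans xw; rewrite lev_subl lev_addr_ge0.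
  - by apply: levv_trans sww; rewrite lev_subl lev_addr_ge0.
  - exact: meet_residual_disjoint.
  - by move/subr0_eq ->; right; exact: levIr.
  - by move/subr0_eq ->; left; exact: levIl.
split=> //; apply/seteqP; split; last first.
  move=> _ [t _ <-] I [[_ _ hZ _] aI]; apply: hZ; exact: aI.
apply: smallest_sub; last by move=> _ ->; exists 1; rewrite ?scale1r.
split.
- by exists 0; rewrite ?scale0r.
- by move=> _ _ [s _ <-] [t _ <-]; exists (s + t); rewrite ?scalerDl.
- by move=> s _ [t _ <-]; exists (s * t); rewrite ?scalerA.
move=> x _ [t _ <-] xt.
have {}xt := levv_trans xt (absv_scale t w).
rewrite (absv_ge0E wge0) in xt.
have [t0|t0] := eqVneq t 0.
  exists 0 => //; rewrite scale0r; apply/esym/eqP.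
  rewrite -normr_le0 -normv_absv -(@normr0 _ X) lev_norm_ge0 ?absv_ge0//.
  by rewrite t0 normr0 scale0r in xt.
have c0 : 0 < `|t| by rewrite normr_gt0.
pose c := `|t|; rewrite -/c in xt c0.
have c20 : 0 <= (2 * c)^-1 by rewrite invr_ge0 mulr_ge0// ltW.
(* Shifting and rescaling carries [[- c *: w, c *: w]] into [[0, w]]. *)
have [||s xs] := line ((2 * c)^-1 *: (x + c *: w)).
- rewrite scalev_ge0// -(subrr x) lev_addl//.
  exact: levv_trans (lev_opp_absv _) xt.
- rewrite [X in _ <=v X](_ : w = (2 * c)^-1 *: (c *: w + c *: w)).
    rewrite lev_scale// lev_add2r//.
    exact: levv_trans (lev_absv _) xt.
  rewrite -scalerDl scalerA -mulr2n -[c *+ 2]mulr_natl mulVf ?scale1r//.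
  by rewrite gt_eqF// mulr_gt0.
exists (2 * c * s - c) => //.
rewrite scalerBl -scalerA -xs scalerA mulfV ?gt_eqF ?mulr_gt0//.
by rewrite scale1r addrK.
Qed.

End VectorLattice.

(** * Consequences of order continuity: approximation and small vectors *)

Section OrderContinuous.
Context {R : realType} {X : banachLatticeType R}.
Hypothesis ocX : order_continuous_norm X.
Implicit Types (x y z a b u v w : X) (A S : set X).

(** The set, indexed by itself in reverse order, is a decreasing net to which order continuity
    applies. *)
Lemma inf0_small A (e : R) : A !=set0 ->
  (forall x y, A x -> A y -> exists z, [/\ A z, z <=v x & z <=v y]) ->
  is_inf A 0 -> 0 < e -> exists2 x, A x & `|x| < e.
Proof.
move=> [x0 Ax0] dirA infA e0.
pose leA (i j : {x | A x}) : Prop := sval j <=v sval i.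
have dirI : directed leA.
  split=> [|[x Ax]|[x Ax] [y Ay] [z Az]/= xy yz|[x Ax] [y Ay]].
  - by split; exists x0.
  - exact: lev_refl.
  - exact: levv_trans yz xy.
  - by have [z [Az zx zy]] := dirA _ _ Ax Ay; exists (exist _ z Az).
have /(_ _ (nbhsx_ballx _ e e0)) : (fun i : {x | A x} => `|sval i|)
    @ tails leA --> (0 : R).
  apply: ocX => //; suff -> : range (sval : {x | A x} -> X) = A by [].
  apply/seteqP; split=> [_ [[x Ax] _ <-]//|x Ax].
  by exists (exist _ x Ax).
move=> [[x Ax] _] /(_ (exist _ x Ax)) /=.
rewrite -ball_normE/= sub0r normrN normr_id => h.
by exists x => //; apply: h; exact: lev_refl.
Qed.

(** If some lower bound [z] of the differences is not below 0, its positive part [w] is a gap: for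
    [s] in [S] with [0 <=v s <=v w], induction keeps every [s *+ n] below [u], which forces
    [s = 0]. *)
Lemma band_gap S u : 0 <=v u -> S 0 ->
  (forall x y, S x -> S y -> S (x + y)) ->
  is_inf [set u - y | y in [set y | [/\ S y, 0 <=v y & y <=v u]]] 0 \/
  exists w, [/\ w != 0, 0 <=v w, w <=v u &
    forall s, S s -> 0 <=v s -> s <=v w -> s = 0].
Proof.
move=> u0 S0 SD; set A := image _ _.
have [|/existsNP[z /not_implyP[zA /negP z0]]] :=
  pselect (forall z, (forall y, A y -> z <=v y) -> z <=v 0).
  by left; split=> // _ [y [_ _ yu] <-]; rewrite subv_ge0.
right; exists (z \/v 0).
have wA y : S y -> 0 <=v y -> y <=v u -> z \/v 0 <=v u - y.
  by move=> Sy y0 yu; rewrite lev_join subv_ge0 yu andbT zA//; exists y.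
split.
- by apply: contra z0 => /eqP <-; exact: levUl.
- exact: levUr.
- by rewrite -[u]subr0; apply: wA => //; exact: lev_refl.
move=> s Ss s0 sw; apply: (@scalev_sub_archimedean _ _ _ u s0) => n.
suff [] : [/\ S (s *+ n), 0 <=v s *+ n & s *+ n <=v u] by [].
elim: n => [|n [Ssn sn0 snu]]; first by rewrite mulr0n; split=> //; exact: lev_refl.
rewrite mulrS; split; [exact: SD|exact: addv_ge0|].
rewrite addrC -lev_subr_addl; apply: levv_trans sw _; exact: wA.
Qed.

(** No supremum of [s] is assumed: the differences between upper bounds and terms are directed
    downwards with infimum 0, so one of them is small and dominates the next increment. *)
Lemma bounded_increasing_small (s : nat -> X) v (e : R) :
  (forall n, s n <=v s n.+1) -> (forall n, s n <=v v) -> 0 < e ->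
  exists n, `|s n.+1 - s n| < e.
Proof.
move=> s1 sv e0.
pose A := [set x | exists b n, (forall k, s k <=v b) /\ x = b - s n].
have smono m n : (m <= n)%N -> s m <=v s n.
  move=> /subnK <-; elim: (n - m)%N => [|k]; first exact: lev_refl.
  by move=> /levv_trans; apply; exact: s1.
have [|||_ [b [n [sb ->]]] sn] := @inf0_small A e _ _ _ e0.
- by exists (v - s 0%N), v, 0%N.
- move=> _ _ [b [m [sb ->]]] [c [n [sc ->]]].
  exists (b /\v c - s (maxn m n)); split.
  + by exists (b /\v c), (maxn m n); split=> // k; rewrite lev_meet sb sc.
  + apply: lev_add; first exact: levIl.
    by rewrite -subv_ge0 opprK addrC subv_ge0 smono// leq_maxl.
  + apply: lev_add; first exact: levIr.
    by rewrite -subv_ge0 opprK addrC subv_ge0 smono// leq_maxr.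
- split=> [_ [b [n [sb ->]]]|z zA]; first by rewrite subv_ge0.
  suff <- : z \/v 0 = 0 by exact: levUl.
  apply: (@scalev_sub_archimedean _ _ _ (v - s 0%N)); first exact: levUr.
  move=> k; rewrite lev_subr_swap.
  (* Subtracting the positive part of [z] from an upper bound of [s] leaves an upper bound, so this
     can be repeated. *)
  elim: k 0%N => [|k IH] n; first by rewrite mulr0n subr0.
  rewrite mulrS addrC opprD addrA lev_subr_swap lev_join subv_ge0 IH andbT.
  by apply: zA; exists (v - (z \/v 0) *+ k), n.
exists n; apply: le_lt_trans sn; apply: lev_norm_ge0; first by rewrite subv_ge0.
exact: lev_add2r.
Qed.

(* If no atom lies below [w], one can split off disjoint pieces of [w] forever;
   their truncations [y_n <= v] have norm at least [d], yet the partial sums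
   stay below [v]. *)
Lemma atomless_has_small w v (d : R) : 0 < d -> 0 <=v v -> w != 0 -> 0 <=v w ->
  (forall a, atom a -> ~ a <=v w) ->
  exists x, [/\ x != 0, 0 <=v x, x <=v w &
    forall t : R, 0 <= t -> `|(t *: x) /\v v| < d].
Proof.
move=> d0 v0 w0 wge0 noatom; apply: contrapT => /forallNP nosmall.
pose P z := [/\ z != 0, 0 <=v z & z <=v w].
(* [p.1] is the part of [z] kept for further splitting and [p.2] the truncation split off. The last
   clause is what bounds the partial sums by [v]. *)
have step z : exists p : X * X, P z -> [/\ P p.1, 0 <=v p.2, d <= `|p.2| &
    forall t : R, 0 <= t -> exists2 t' : R, 0 <= t' &
      p.2 + (t *: p.1) /\v v <=v (t' *: z) /\v v].
  have [[z0 zge0 zw]|nPz] := pselect (P z); last by exists 0.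
  have [a [b [[age0 bge0 az] bz ab [a0 b0]]]] : exists a b,
      [/\ [/\ 0 <=v a, 0 <=v b & a <=v z], b <=v z, a /\v b = 0
        & a != 0 /\ b != 0].
    apply: contrapT => /forallNP nosplit; apply: (noatom z) => //.
    apply: indecomposable_atom => // a b age0 bge0 az bz ab.
    have [|a0] := eqVneq a 0; first by left.
    have [|b0] := eqVneq b 0; first by right.
    by case: (nosplit a); exists b.
  have [s [s0 sa]] : exists s : R, 0 <= s /\ d <= `|(s *: a) /\v v|.
    apply: contrapT => /forallNP small; apply: (nosmall a).
    split=> // [|t t0]; first exact: levv_trans zw.
    by rewrite ltNge; apply/negP => ?; apply: (small t).
  have sa0 : 0 <=v (s *: a) /\v v by rewrite meetv_ge0// scalev_ge0.
  exists (b, (s *: a) /\v v) => _; split=> //=.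
    by split=> //; exact: levv_trans zw.
  move=> t t0; have tb0 : 0 <=v (t *: b) /\v v by rewrite meetv_ge0// scalev_ge0.
  (* This multiple of [z] dominates both [s *: a] and [t *: b], whose truncations are disjoint and
     thus add up below its truncation. *)
  exists (Num.max s t); first by rewrite le_max s0.
  apply: disjoint_add_le => //.
  - apply: lev_le0_anti; first exact: meetv_ge0.
    pose r := Num.max 1 (Num.max s t).
    have r0 : 0 <= r by rewrite le_max ler01.
    have r1 : 0 <= r^-1 by rewrite invr_ge0.
    have rp : 0 < r by rewrite lt_max ltr01.
    have rn0 : r != 0 by rewrite gt_eqF.
    set m := _ /\v _.
    have : r^-1 *: m <=v a /\v b.
      rewrite lev_meet; apply/andP; split.
        rewrite -[a]scale1r -(mulVf rn0) -scalerA lev_scale//.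
        apply: levv_trans (levIl _ _) _; apply: levv_trans (levIl _ _) _.
        by rewrite lev_scale_ge// !le_max lexx orbT.
      rewrite -[b]scale1r -(mulVf rn0) -scalerA lev_scale//.
      apply: levv_trans (levIr _ _) _; apply: levv_trans (levIl _ _) _.
      by rewrite lev_scale_ge// !le_max lexx !orbT.
    rewrite ab => /(lev_scale r0).
    by rewrite scaler0 scalerA mulfV ?gt_eqF// scale1r.
  - apply: lev_meet2 (lev_refl _).
    by apply: levv_trans (lev_scale_ge _ age0) (lev_scale _ az);
      rewrite le_max ?lexx ?s0.
  - apply: lev_meet2 (lev_refl _).
    apply: levv_trans (lev_scale_ge _ bge0) (lev_scale _ bz);
      by rewrite le_max ?lexx ?s0 ?orbT.
have [f fP] := choice step.
pose W n := iter n (fun z => (f z).1) w.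
pose s n := \sum_(k < n) (f (W k)).2.
have PW n : P (W n).
  elim: n => [|n /fP[]//]; split=> //; exact: lev_refl.
have sS n : s n.+1 = s n + (f (W n)).2 by rewrite /s big_ord_recr.
(* Keeping a truncated multiple of the remainder in the bound makes the induction go through. *)
have sW n t : 0 <= t -> s n + (t *: W n) /\v v <=v v.
  elim: n t => [|n IH] t t0.
    by rewrite /s big_ord0 add0r levIr.
  have [_ _ _ /(_ _ t0)[t' t'0 h]] := fP _ (PW n).
  apply: levv_trans (IH _ t'0).
  by rewrite sS -addrA lev_addl.
have sv n : s n <=v v.
  apply: levv_trans (sW n 0 (lexx _)).
  by rewrite lev_addr_ge0// scale0r meetv_ge0// lev_refl.
have [n|n] := bounded_increasing_small _ sv d0.
  by rewrite sS lev_addr_ge0//; have [] := fP _ (PW n).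
rewrite sS addrAC subrr add0r ltNge.
by have [_ _ ->] := fP _ (PW n).
Qed.

(** For [x] outside the band [B] of the atoms, [absv x] is not the supremum of the vectors of [B]
    below it. The resulting gap contains no atom, as atoms lie in [B]. *)
Lemma not_atomic_atomless : ~ atomic X -> exists w,
  [/\ w != 0, 0 <=v w & forall a, atom a -> ~ a <=v w].
Proof.
move=> natomic; pose B := smallest band [set a : X | atom a].
have [[B0 BD _ BS] Bsup] : band B by exact: smallest_band.
have [x Bx] : exists x, ~ B x.
  apply: contrapT => /forallNP nB; apply: natomic.
  by apply/seteqP; split=> // x _; apply: contrapT; exact: nB.
have [infB|[w [w0 wge0 _ wB]]] := band_gap (absv_ge0 x) B0 BD.
  case: Bx; apply: (BS _ (absv x)).
    apply: (Bsup [set y | [/\ B y, 0 <=v y & y <=v absv x]]) => [y []//|].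
    split=> [y []//|z zB]; rewrite -[z]add0r -lev_subl.
    apply: infB.2 => _ [y By <-]; apply: lev_addl.
    by rewrite -subv_ge0 opprK addrC subv_ge0; exact: zB.
  by rewrite (absv_ge0E (absv_ge0 x)) lev_refl.
exists w; split=> // a aatom aw; have [a0 age0 _] := aatom.
suff ae : a = 0 by rewrite ae eqxx in a0.
by apply: wB => //; exact: sub_gen_smallest.
Qed.

End OrderContinuous.

(** * Convex un-neighborhoods controlled by a single vector *)

Section UnConvexity.
Context {R : realType} {X : banachLatticeType R}.
Implicit Types (x y z a u v w : X).

Lemma un_ball_lipschitz (e : R) u v x : 0 <=v u -> 0 <=v v ->
  un_ball e u x -> un_ball (e + `|v - u|) v x.
Proof.
move=> u0 v0 xe; rewrite /un_ball/=.
apply: (@le_lt_trans _ _ `|absv x /\v u + absv (v - u)|).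
  apply: lev_norm_ge0; first by rewrite meetv_ge0// absv_ge0.
  have d0 := absv_ge0 (v - u).
  rewrite -lev_subl lev_meet !lev_subl; apply/andP; split.
    exact: levv_trans (levIl _ _) (lev_addr_ge0 _ d0).
  apply: levv_trans (levIr _ _) _; rewrite addrC -lev_subl; exact: lev_absv.
by apply: le_lt_trans (ler_normD _ _) _; rewrite normv_absv ltrD2r.
Qed.

Lemma open_un_ball (e : R) u : 0 <=v u -> open (un_ball e u : set (un X)).
Proof.
move=> u0; rewrite openE => x xe; have {}xe : `|absv (x : X) /\v u| < e := xe.
pose t := (`|absv (x : X) /\v u| + e) / 2.
exists (e - t, u); first by split=> //=; rewrite subr_gt0 /t; lra.
move=> y /= yx; suff : un_ball (t + (e - t)) u (x + (y - x) : X).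
  by rewrite addrC subrK addrC subrK.
by apply: un_ballD => //; rewrite /un_ball/= /t; lra.
Qed.

Lemma open_un_shift (x : un X) (W : set (un X)) : open W ->
  open [set y : un X | W (y - x)].
Proof.
rewrite !openE => oW y /oW [[e u] /= eu sW]; exists (e, u) => // z /= zy.
by apply: sW => /=; rewrite opprB addrA subrK.
Qed.

(** [W] is open, not merely a neighborhood, so that its translates can enter a basis. *)
Definition locally_convex_at u := forall e : R, 0 < e ->
  exists W : set (un X), [/\ W 0, open W, convex_set W & W `<=` un_ball e (absv u)].

Lemma locally_convex_at_solid u v : absv u <=v absv v ->
  locally_convex_at v -> locally_convex_at u.
Proof.
move=> uv vc e /vc[W [W0 oW cW sW]]; exists W; split=> //.
apply: subset_trans sW _; apply: un_ballS => //; exact: absv_ge0.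
Qed.

Lemma locally_convex_atD u v :
  locally_convex_at u -> locally_convex_at v -> locally_convex_at (u + v).
Proof.
move=> uc vc e e0; have e20 : 0 < e / 2 by rewrite divr_gt0.
have [W [W0 oW cW sW]] := uc _ e20; have [V [V0 oV cV sV]] := vc _ e20.
exists (W `&` V); split=> //; first exact: openI.
  move=> x y l /[!inE] -[Wx Vx] [Wy Vy]; split.
    by apply/set_mem; apply: cW; exact/mem_set.
  by apply/set_mem; apply: cV; exact/mem_set.
move=> x [/sW xu /sV xv]; rewrite /un_ball/=.
have [[ax au] av] := (absv_ge0 x, absv_ge0 u, absv_ge0 v).
apply: (@le_lt_trans _ _ `|absv x /\v absv u + absv x /\v absv v|).
  apply: lev_norm_ge0; first by rewrite meetv_ge0// absv_ge0.
  rewrite ![absv x /\v _]meetvC.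
  apply: levv_trans (meetv_add au av ax).
  by rewrite lev_meet2 ?lev_refl// absv_add.
by apply: le_lt_trans (ler_normD _ _) _; rewrite [e]splitr; exact: ltrD.
Qed.

Lemma locally_convex_atZ (t : R) u :
  locally_convex_at u -> locally_convex_at (t *: u).
Proof.
move=> uc e e0; pose s := `|t| + 1; have s1 : 1 <= s by rewrite lerDr.
have s0 : 0 < s by exact: lt_le_trans s1.
have [|W [W0 oW cW sW]] := uc (e / s); first by rewrite divr_gt0.
exists W; split=> // x /sW; rewrite /un_ball/= ltr_pdivlMr// => h.
apply: le_lt_trans h; rewrite mulrC -[X in X * _](gtr0_norm s0) -normrZ.
have [ax au] := (absv_ge0 x, absv_ge0 u).
apply: lev_norm_ge0; first by rewrite meetv_ge0// absv_ge0.
rewrite ![absv x /\v _]meetvC.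
have ts : `|t| <= s by rewrite lerDl.
apply: levv_trans (meetv_scale s1 ts au ax).
by rewrite lev_meet2 ?lev_refl// absv_scale.
Qed.

Lemma locally_convex_at_closed u :
  (forall e : R, 0 < e -> exists2 v, locally_convex_at v & `|u - v| < e) ->
  locally_convex_at u.
Proof.
move=> uc e e0; have e20 : 0 < e / 2 by rewrite divr_gt0.
have [v vc uv] := uc _ e20; have [W [W0 oW cW sW]] := vc _ e20.
exists W; split=> // x /sW xv.
(* [u'] dominates [absv u], yet is as close to [absv v] as [u] is to [v]. *)
pose u' := absv v + absv (u - v).
have u'v : `|u' - absv v| < e / 2 by rewrite addrAC subrr add0r normv_absv.
have u'0 : 0 <=v u' by rewrite addv_ge0 ?absv_ge0.
have := un_ball_lipschitz (absv_ge0 v) u'0 xv.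
apply: un_ballS; [|exact: absv_ge0|].
  by rewrite [leRHS]splitr lerD2l ltW.
by rewrite -{1}[u](subrK v) addrC /u' absv_add.
Qed.

Lemma locally_convex_at_atom a : atom a -> locally_convex_at a.
Proof.
move=> aatom e e0; have [a0 age0 _] := aatom.
have na : 0 < `|a| by rewrite normr_gt0.
pose d := Num.min e `|a|; have d0 : 0 < d by rewrite lt_min e0.
rewrite (absv_ge0E age0); exists (un_ball d a); split; last first.
- by apply: un_ballS => //; [rewrite ge_min lexx|exact: lev_refl].
(* For general [a] only the reverse inequality holds. Here [(p *: absv x) /\v a] is [p] times
   [absv x /\v (p^-1 *: a)], and enlarging [a] to [p^-1 *: a] does not change the meet. *)
- have contract x (p : R) : 0 < p -> p <= 1 -> un_ball d a x ->
      `|(p *: absv x) /\v a| <= p * `|absv x /\v a|.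
    move=> p0 p1 xd; have ax := absv_ge0 x.
    have pV : 1 <= p^-1 by rewrite invf_ge1.
    have pa0 : 0 <=v p^-1 *: a by rewrite scalev_ge0// invr_ge0 ltW.
    have line (k : R) : 0 <= k -> exists t : R, absv x /\v (k *: a) = t *: a.
      move=> k0; apply: (interval_atom aatom k0); last exact: levIr.
      by rewrite meetv_ge0// scalev_ge0.
    have [s] := line 1 ler01; rewrite scale1r => xs.
    have [t xt] := line p^-1 (le_trans ler01 pV).
    (* Meeting with [a] gives [s = min t 1], and [s < 1] since the ball has radius at most the norm
       of [a]. *)
    have ts : t = s.
      have s1 : `|s| < 1.
        rewrite -(ltr_pM2r na) mul1r -normrZ -xs; apply: lt_le_trans xd _.
        by rewrite ge_min lexx orbT.
      have aVa : a <=v p^-1 *: a by rewrite -{1}[a]scale1r lev_scale_ge.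
      have sE : s *: a = (t *: a) /\v a.
        apply: lev_anti; rewrite -xs -xt lev_meet levIr lev_meet levIl/=.
        rewrite (levv_trans (levIr _ _) aVa)/= lev_meet levIr andbT.
        by rewrite (levv_trans (levIl _ _) (levIl _ _)).
      have [t1|/ltW t1] := leP t 1.
        rewrite meetv_idPl in sE; first by apply/esym; exact: scalev_inj sE.
        by rewrite -[X in _ <=v X]scale1r lev_scale_ge.
      rewrite meetvC meetv_idPl in sE; last by rewrite -{1}[a]scale1r lev_scale_ge.
      have : s = 1 by apply: (scalev_inj a0); rewrite sE scale1r.
      by move=> s1'; rewrite s1' normr1 ltxx in s1.
    rewrite -[X in X * _](gtr0_norm p0) -normrZ; apply: lev_norm_ge0.
      by rewrite meetv_ge0// scalev_ge0// ltW.
    have pn0 : p != 0 by rewrite gt_eqF.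
    rewrite xs -ts -xt -[X in X <=v _](scalerKV pn0) lev_scale ?ltW// lev_meet.
    rewrite -{2}[absv x](scalerK pn0) !lev_scale ?levIl ?levIr//;
      by rewrite invr_ge0 ltW.
  apply/convex_setW => x y /[!inE] xd yd l l0 l1.
  have [x0 y0] := (absv_ge0 x, absv_ge0 y).
  have m0 : 0 < 1 - l%:num by rewrite subr_gt0.
  have m1 : 1 - l%:num <= 1 by rewrite gerBl.
  have lx0 : 0 <=v l%:num *: absv x by rewrite scalev_ge0.
  have my0 : 0 <=v (1 - l%:num) *: absv y by rewrite scalev_ge0// ltW.
  apply/mem_set.
  change (`|absv (l%:num *: x + (1 - l%:num) *: y) /\v a| < d).
  apply: (@le_lt_trans _ _ (`|(l%:num *: absv x) /\v a +
                             ((1 - l%:num) *: absv y) /\v a|)).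
    apply: lev_norm_ge0; first by rewrite meetv_ge0// absv_ge0.
    apply: levv_trans (meetv_add lx0 my0 age0).
    apply: lev_meet2 (lev_refl _); apply: levv_trans (absv_add _ _) _.
    apply: lev_add; apply: levv_trans (absv_scale _ _) _.
      by rewrite gtr0_norm// lev_refl.
    by rewrite gtr0_norm// lev_refl.
  apply: le_lt_trans (ler_normD _ _) _.
  apply: le_lt_trans (lerD (contract _ _ l0 (ltW l1) xd) (contract _ _ m0 m1 yd)) _.
  have -> : d = l%:num * d + (1 - l%:num) * d by rewrite -mulrDl addrC subrK mul1r.
  by apply: ltrD; rewrite ltr_pM2l.
- exact: open_un_ball.
- exact: un_ball0.
Qed.

End UnConvexity.

(** * The two implications *)

Section LocalConvexity.
Context {R : realType} {X : banachLatticeType R}.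
Hypothesis ocX : order_continuous_norm X.
Implicit Types (x y z a u v w : X).

Lemma locally_convex_at0 : locally_convex_at (0 : X).
Proof.
move=> e e0; exists setT; split=> //; first exact: openT.
move=> x _; rewrite /un_ball/= absv0 (_ : _ /\v 0 = 0) ?normr0//.
by apply: lev_anti; rewrite levIr lev_meet lev_refl absv_ge0.
Qed.

Lemma band_locally_convex_at : band (@locally_convex_at R X).
Proof.
split.
  split; [exact: locally_convex_at0|exact: locally_convex_atD|
          exact: locally_convex_atZ|].
  by move=> x y yc xy; exact: locally_convex_at_solid xy yc.
move=> D x DG [Dx xleast].
(* A supremum of the empty set is a least element, hence 0. *)
have [[d0 Dd0]|D0] := pselect (D !=set0); last first.
  have xle z : x <=v z by apply: xleast => y Dy; case: D0; exists y.
  suff -> : x = 0 by exact: locally_convex_at0.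
  apply: lev_le0_anti => //.
  by have := xle (x + x); rewrite -{1}[x]addr0 -subv_ge0 addrKA subr0.
apply: locally_convex_at_closed => e e0.
(* [D] need not be directed, so it is enlarged to all such vectors below [x], which are closed under
   joins. *)
pose A := [set x - y | y in [set y | locally_convex_at y /\ y <=v x]].
have [|||_ [y [yc yx] <-] xye] := @inf0_small _ _ ocX A e _ _ _ e0.
- by exists (x - d0), d0 => //; split; [exact: DG|exact: Dx].
- move=> _ _ [y [yc yx] <-] [z [zc zx] <-]; exists (x - (y \/v z)); split.
  + exists (y \/v z) => //; split; last by rewrite lev_join yx.
    apply: locally_convex_at_solid (_ : absv _ <=v absv (absv y + absv z)) _.
      by rewrite (absv_ge0E (addv_ge0 (absv_ge0 y) (absv_ge0 z))) absv_joinv.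
    have absc u : locally_convex_at u -> locally_convex_at (absv u).
      by apply: locally_convex_at_solid; rewrite (absv_ge0E (absv_ge0 u)) lev_refl.
    by apply: locally_convex_atD; exact: absc.
  + by apply: lev_addl; rewrite -subv_ge0 opprK addrC subv_ge0 levUl.
  + by apply: lev_addl; rewrite -subv_ge0 opprK addrC subv_ge0 levUr.
- split=> [_ [y [_ yx] <-]|z zA]; first by rewrite subv_ge0.
  suff : x <=v x - z by rewrite lev_subr_swap subrr.
  apply: xleast => y Dy; rewrite lev_subr_swap; apply: zA.
  by exists y => //; split; [exact: DG|exact: Dx].
by exists y.
Qed.

Lemma atomic_un_locally_convex : atomic X -> is_locally_convex (un X).
Proof.
move=> atomX.
have lc u : locally_convex_at u.
  suff : smallest band [set a : X | atom a] `<=` @locally_convex_at R X.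
    by rewrite atomX; apply.
  apply: smallest_sub; first exact: band_locally_convex_at.
  exact: locally_convex_at_atom.
exists [set b : set (un X) | open b /\ convex_set b].
  by move=> b /set_mem[].
split=> [b []//|x A [[e u] /= [e0 u0]] sA].
have [W [W0 oW cW sW]] := lc u e e0.
exists [set y : un X | W (y - x)] => /=.
  split; last by rewrite subrr.
  split; first exact: open_un_shift.
  move=> y z l /set_mem Wy /set_mem Wz; apply/mem_set.
  have /set_mem := cW _ _ l (mem_set Wy) (mem_set Wz).
  congr (W _).
  change (l%:num *: (y - x : X) + (1 - l%:num) *: (z - x : X)
    = l%:num *: y + (1 - l%:num) *: z - x).
  rewrite !scalerBr addrACA -opprD -scalerDl [in X in X *: x]addrC subrK.
  by rewrite scale1r.
by move=> y /sW; rewrite (absv_ge0E u0) => /sA.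
Qed.

(* With [W] convex, [un_ball d v `<=` W] and [L] the largest cone of positive
   vectors whose order intervals, dilated at will, stay in [W], a vector [y]
   belongs to [L] as soon as every truncation [(t *: y) /\v v] is small.
   Without atoms such vectors exist below any positive vector, so [L] is
   order dense below [u], whereas a vector of [L] near [u] would lie
   in the prescribed neighborhood [un_ball (`|u| / 2) u]. *)
Lemma un_locally_convex_atomic : is_locally_convex (un X) -> atomic X.
Proof.
move=> [B cB [oB bB]]; apply: contrapT => /not_atomic_atomless.
move=> [u [u0 uge0 noatom]].
have nu : 0 < `|u| / 2 by rewrite divr_gt0// normr_gt0.
have [|W [BW W0] sW] := bB (0 : un X) (un_ball (`|u| / 2) u).
  by exists (`|u| / 2, u) => // y /=; rewrite subr0.
have cW x y (p : R) : 0 <= p <= 1 -> W x -> W y -> W (p *: x + (1 - p) *: y).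
  move=> /andP[p0 p1] Wx Wy.
  exact: set_mem (cB W (mem_set BW) x y (Itv01 p0 p1) (mem_set Wx) (mem_set Wy)).
have [[d v] /= [d0 v0] sd] : nbhs (0 : un X) W.
  by have := oB _ BW; rewrite openE; exact.
pose L y := 0 <=v y /\ forall (t : R) z, 0 <= t -> 0 <=v z -> z <=v t *: y -> W z.
(* Split [z] into [z /\v (t *: x)] and a rest below [t *: y]. Since [L] allows any dilation, the
   doubles of both parts are in [W], and [z] is their midpoint. *)
have LD x y : L x -> L y -> L (x + y).
  move=> [x0 Lx] [y0 Ly]; split; first exact: addv_ge0.
  move=> t z t0 z0; rewrite scalerDr => zxy.
  have zxle : z /\v (t *: x) <=v z by exact: levIl.
  have zx0 : 0 <=v z /\v (t *: x) by rewrite meetv_ge0// scalev_ge0.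
  have W1 : W (2 *: (z /\v (t *: x))).
    apply: (Lx (2 * t)); rewrite ?mulr_ge0 ?scalev_ge0// -scalerA.
    by rewrite lev_scale// levIr.
  have W2 : W (2 *: (z - z /\v (t *: x))).
    apply: (Ly (2 * t)); rewrite ?mulr_ge0 ?scalev_ge0 ?subv_ge0// -scalerA.
    rewrite lev_scale// lev_subl addrC -lev_subl lev_meet !lev_subl zxy andbT.
    by rewrite lev_addr_ge0// scalev_ge0.
  have -> : z = 2^-1 *: (2 *: (z /\v (t *: x)))
      + (1 - 2^-1) *: (2 *: (z - z /\v (t *: x))).
    have -> : 1 - 2^-1 = 2^-1 :> R by lra.
    by rewrite !(scalerK (_ : 2 != 0 :> R)) ?pnatr_eq0// addrC subrK.
  by apply: cW => //; lra.
have L0 : L 0.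
  split=> [|t z _ z0]; first exact: lev_refl.
  by rewrite scaler0 => /(lev_le0_anti z0) ->.
(* Either some [y] in [L] is within half the norm of [u] from [u], while [y] in [W] has norm below
   that half; or a gap [w] exists, and the small vector found below it is a nonzero member of
   [L]. *)
have [infL|[w [w0 wge0 wu Lw]]] := band_gap uge0 L0 LD.
  have [||_ [y [[y0 Ly] _ yu] <-] uy] := inf0_small ocX _ _ infL nu.
  - by exists (u - 0), 0 => //; split=> //; exact: lev_refl.
  - move=> _ _ [y [Ly y0 yu] <-] [z [Lz z0 zu] <-].
    exists (u - (y \/v z)); split.
    + have yz0 : 0 <=v y \/v z by exact: levv_trans y0 (levUl _ _).
      exists (y \/v z) => //; split=> //; last by rewrite lev_join yu.
      split=> // t x t0 x0 xt; have [_ Lyz] := LD _ _ Ly Lz.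
      apply: (Lyz t) => //; apply: levv_trans xt (lev_scale t0 _).
      exact: joinv_le_addr.
    + by apply: lev_addl; rewrite -subv_ge0 opprK addrC subv_ge0 levUl.
    + by apply: lev_addl; rewrite -subv_ge0 opprK addrC subv_ge0 levUr.
  have /sW : W y by apply: (Ly 1); rewrite ?scale1r ?lev_refl.
  rewrite /un_ball/= (absv_ge0E y0) meetv_idPl// => yn.
  have := ler_normD (u - y) y; rewrite subrK leNgt [ltRHS]splitr.
  by rewrite ltrD.
have [|x [x0 xge0 xw small]] := atomless_has_small ocX d0 v0 w0 wge0.
  by move=> a aa aw; apply: (noatom a aa); exact: levv_trans wu.
case/negP: x0; apply/eqP; apply: Lw => //; split=> // t z t0 z0 zt.
apply: sd; rewrite /= subr0; apply: le_lt_trans (small t t0).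
rewrite (absv_ge0E z0); apply: lev_norm_ge0; first exact: meetv_ge0.
by rewrite lev_meet2// lev_refl.
Qed.

End LocalConvexity.

Theorem theorem5p2 (R : realType) (X : banachLatticeType R) :
  order_continuous_norm X -> (is_locally_convex (un X) <-> atomic X).
Proof.
move=> ocX; split; first exact: un_locally_convex_atomic.
exact: atomic_un_locally_convex.
Qed.
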